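(* Let $(Y,\gamma)$ be a GTspace. Then the following are equivalent. (1) $(Y,\gamma)$ is $s\lambda$-normal. (2) For every pair of $s\lambda$-open sets $E,F$ with $E\cup F=Y$, there exist $s\lambda$-closed sets $A,B$ such that $A\subset E$, $B\subset F$ and $A\cup B=Y$. (3) For every $s\lambda$-closed set $A$ and every $s\lambda$-open set $G$ containing $A$, there exists an $s\lambda$-open set $E$ such that $A\subset E\subset\mathrm{cl}_{s\lambda}(E)\subset G$. (4) Every pair of disjoint $s\lambda$-closed sets is $s\lambda$-strongly separated.
   Context: A generalized topology on a nonempty set $Y$ is a collection $\gamma$ of subsets of $Y$ with $\emptyset\in\gamma$ that is closed under arbitrary unions; $(Y,\gamma)$ is then called a GTspace (it is not required that $Y\in\gamma$, nor closure under finite intersections). Members of $\gamma$ are called $\gamma$-open and their complements $\gamma$-closed; the $\gamma$-closure $\overline{D}_\gamma$ of $D\subset Y$ is the intersection of all $\gamma$-closed sets containing $D$. A set $D\subset Y$ is $s\gamma$-open if there is a $\gamma$-open set $V$ with $V\subset D\subset\overline{V}_\gamma$; $D$ is $s\gamma$-closed if $Y-D$ is $s\gamma$-open. $\mathrm{sker}_\gamma(D)$ is the intersection of all $s\gamma$-open sets containing $D$. A set $D\subset Y$ is $s\lambda$-closed if $D=M\cap N$ for some $M$ with $M=\mathrm{sker}_\gamma(M)$ and some $s\gamma$-closed set $N$; $D$ is $s\lambda$-open if $Y-D$ is $s\lambda$-closed. The $s\lambda$-closure $\mathrm{cl}_{s\lambda}(D)$ is the set of all $y\in Y$ such that every $s\lambda$-open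 set containing $y$ meets $D$. $(Y,\gamma)$ is $s\lambda$-normal if for any pair of disjoint $s\lambda$-closed sets $A,B$ there exist $s\lambda$-open sets $E,F$ with $A\subset E$, $B\subset F$ and $\mathrm{cl}_{s\lambda}(E)\cap\mathrm{cl}_{s\lambda}(F)=\emptyset$. Two sets $A,B\subset Y$ are $s\lambda$-strongly separated if there are $s\lambda$-open sets $E,F$ with $A\subset E$, $B\subset F$ and $E\cap F=\emptyset$. *)

(* Defs.v *)
From mathcomp Require Import all_boot.
From mathcomp Require Import classical_sets.

Set Implicit Arguments.
Unset Strict Implicit.
Unset Printing Implicit Defensive.

Local Open Scope classical_set_scope.

(* Neither [set: Y] \in gamma nor stability under finite intersections is
   required. *)
Record generalized_topology (Y : Type) (gamma : set (set Y)) : Prop := {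
  gt_set0 : gamma set0 ;
  gt_bigcup : forall S : set (set Y),
    S `<=` gamma -> gamma (\bigcup_(U in S) U) }.

Section GeneralizedTopology.
Variables (Y : Type) (gamma : set (set Y)).
Implicit Types A B C D E F G M N U V : set Y.

Definition gclosed D : Prop := gamma (~` D).

Definition gclosure D : set Y :=
  \bigcap_(C in [set C | gclosed C /\ D `<=` C]) C.

Definition sg_open D : Prop :=
  exists V, [/\ gamma V, V `<=` D & D `<=` gclosure V].

Definition sg_closed D : Prop := sg_open (~` D).

(* If no sg_open set contains D, the intersection is over the empty family
   and sker D is the whole space. *)
Definition sker D : set Y :=
  \bigcap_(U in [set U | sg_open U /\ D `<=` U]) U.

Definition sl_closed D : Prop :=
  exists M N, [/\ M = sker M, sg_closed N & D = M `&` N].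

Definition sl_open D : Prop := sl_closed (~` D).

Definition sl_closure D : set Y :=
  [set y | forall U, sl_open U -> U y -> U `&` D !=set0].

Definition sl_normal : Prop :=
  forall A B, sl_closed A -> sl_closed B -> A `&` B = set0 ->
  exists E F, [/\ sl_open E, sl_open F, A `<=` E, B `<=` F
                & sl_closure E `&` sl_closure F = set0].

Definition sl_strongly_separated A B : Prop :=
  exists E F, [/\ sl_open E, sl_open F, A `<=` E, B `<=` F
                & E `&` F = set0].

End GeneralizedTopology.

(* Main.v *)
Require Import Defs.
From mathcomp Require Import all_boot.
From mathcomp Require Import boolp classical_sets.

(** The four statements say in different ways that disjoint sl-closed sets can
    be separated, and the usual argument for normality of topological spaces
    carries over because it rests on two properties of the closure only:
    sl-closures are sl-closed ([sl_closed_sl_closure]), and the sl-closure of a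
    set lies in every sl-closed set around it ([sl_closure_sub]).

    The second fact is immediate from the pointwise definition of the
    sl-closure. The first one holds since sl-closed sets are stable under
    arbitrary intersections ([sl_closed_bigcap]), which splits into the same
    stability for the two factors of an sl-closed set: it is formal for fixed
    points of the closure operator [sker], and for sg-closed sets it is dual to
    the stability of sg-open sets under unions ([sg_open_bigcup]), which
    comes from the stability of open sets under unions.

    Given this, (1), (2) and (3) imply (2), (3) and (4) by taking complements;
    from (4) back to (1), separation is applied twice, the second time to the
    closure of a neighbourhood obtained the first time, so as to pass from
    disjoint open sets to disjoint closures. *)

Local Open Scope classical_set_scope.

Section SemiLambda.
Context {Y : Type} {gamma : set (set Y)}.
Implicit Types A B C D E G U : set Y.

Lemma gclosureS D E : D `<=` E -> gclosure gamma D `<=` gclosure gamma E.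
Proof. by move=> DE y Dy C [cC EC]; apply: Dy; split=> // z /DE/EC. Qed.

Lemma sub_sker D : D `<=` sker gamma D.
Proof. by move=> y Dy U [_]; apply. Qed.

Lemma skerS D E : D `<=` E -> sker gamma D `<=` sker gamma E.
Proof. by move=> DE y Dy U [oU EU]; apply: Dy; split=> // z /DE/EU. Qed.

Lemma sker_id D : sker gamma (sker gamma D) = sker gamma D.
Proof.
apply/seteqP; split; last exact: sub_sker.
by move=> y sy U [oU DU]; apply: sy; split=> // z; apply.
Qed.

Lemma sl_closedC D : sl_closed gamma D -> sl_open gamma (~` D).
Proof. by rewrite /sl_open setCK. Qed.

Lemma sub_sl_closure D : D `<=` sl_closure gamma D.
Proof. by move=> y Dy U _ Uy; exists y. Qed.

Lemma sl_closure_sub D C :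
  sl_closed gamma C -> D `<=` C -> sl_closure gamma D `<=` C.
Proof.
move=> cC DC y Dy; apply: contrapT => nCy.
by have [z [nCz /DC]] := Dy _ (sl_closedC _ cC) nCy.
Qed.

Lemma sl_closureE D :
  sl_closure gamma D = \bigcap_(C in [set C | sl_closed gamma C /\ D `<=` C]) C.
Proof.
apply/seteqP; split=> [y Dy C [cC DC]|y capy U oU Uy].
  exact: sl_closure_sub DC _ Dy.
apply: contrapT => /set0P/negP; rewrite negbK => /eqP UD0.
suff: (~` U) y by [].
by apply: capy; split=> // z Dz Uz; rewrite -[False]/(set0 z) -UD0.
Qed.

Context (gamma_gt : generalized_topology gamma).

(** The union of all admissible open cores of all members serves as a core of
    the union, which avoids choosing one core for each member. *)
Lemma sg_open_bigcup (S : set (set Y)) :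
  S `<=` sg_open gamma -> sg_open gamma (\bigcup_(D in S) D).
Proof.
move=> oS.
pose T := [set V | gamma V /\
  exists D, [/\ S D, V `<=` D & D `<=` gclosure gamma V]].
exists (\bigcup_(V in T) V); split.
- by apply: gt_bigcup => // V [].
- by move=> y [V [_ [D [SD VD _]]] Vy]; exists D => //; apply: VD.
- move=> y [D SD Dy]; have [V [oV VD DV]] := oS _ SD.
  have TV : T V by split=> //; exists D.
  by apply: gclosureS (DV _ Dy) => z Vz; exists V.
Qed.

Lemma sg_closed_bigcap (S : set (set Y)) :
  S `<=` sg_closed gamma -> sg_closed gamma (\bigcap_(N in S) N).
Proof.
move=> cS; rewrite /sg_closed setC_bigcap -(bigcup_image S setC id).
by apply: sg_open_bigcup => _ [N SN <-]; apply: cS.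
Qed.

(** The intersection is written with the canonical factors: its own kernel and
    the least sg-closed set around it. For each member [M `&` N] of the family,
    the first factor lies in [M], which is a kernel, and the second one in [N],
    which is sg-closed, so their intersection lies in every member. *)
Lemma sl_closed_bigcap (S : set (set Y)) :
  S `<=` sl_closed gamma -> sl_closed gamma (\bigcap_(D in S) D).
Proof.
move=> cS; set I := \bigcap_(D in S) D.
exists (sker gamma I),
  (\bigcap_(N in [set N | sg_closed gamma N /\ I `<=` N]) N).
split; first by rewrite sker_id.
  by apply: sg_closed_bigcap => N [].
apply/seteqP; split=> [y Iy|y [kIy cIy] D SD].
  by split; [exact: sub_sker|move=> N [_]; apply].
have [M [N [kM cN DMN]]] := cS _ SD.
have IMN : I `<=` M `&` N by move=> z /(_ _ SD); rewrite DMN.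
rewrite DMN; split.
  by rewrite kM; apply: skerS kIy => z /IMN[].
by apply: cIy; split=> // z /IMN[].
Qed.

Lemma sl_closed_sl_closure D : sl_closed gamma (sl_closure gamma D).
Proof. by rewrite sl_closureE; apply: sl_closed_bigcap => C []. Qed.

End SemiLambda.

Theorem theorem3p12 (Y : Type) (gamma : set (set Y))
    (Y_nonempty : [set: Y] !=set0)
    (gamma_gt : generalized_topology gamma) :
  [<-> (* 1 *) sl_normal gamma;
       (* 2 *) forall E F : set Y,
         sl_open gamma E -> sl_open gamma F -> E `|` F = setT ->
         exists A B : set Y,
           [/\ sl_closed gamma A, sl_closed gamma B, A `<=` E, B `<=` F
             & A `|` B = setT];
       (* 3 *) forall A G : set Y,
         sl_closed gamma A -> sl_open gamma G -> A `<=` G ->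
         exists E : set Y,
           [/\ sl_open gamma E, A `<=` E, E `<=` sl_closure gamma E
             & sl_closure gamma E `<=` G];
       (* 4 *) forall A B : set Y,
         sl_closed gamma A -> sl_closed gamma B -> A `&` B = set0 ->
         sl_strongly_separated gamma A B].
Proof.
tfae.
- move=> normal E F oE oF EFT.
  have [|U [V [oU oV EU FV UV0]]] := normal _ _ oE oF.
    by rewrite -setCU EFT setCT.
  exists (~` U), (~` V); split=> //.
  + by rewrite -(setCK E); apply: subsetC.
  + by rewrite -(setCK F); apply: subsetC.
  + rewrite -setCI -setC0; congr (~` _); apply/seteqP; split=> // y [Uy Vy].
    by rewrite -UV0; split; apply: sub_sl_closure.
- move=> cover A G cA oG AG.
  have [|C [D [cC cD CG DA CDT]]] := cover _ _ oG (sl_closedC _ cA).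
    rewrite -subTset => y _.
    by case: (pselect (A y)) => [/AG Gy|nAy]; [left|right].
  have DC : ~` D `<=` C.
    by move=> y nDy; have [] : (C `|` D) y by rewrite CDT.
  exists (~` D); split; first exact: sl_closedC.
  + by move=> y Ay /DA.
  + exact: sub_sl_closure.
  + exact: subset_trans (sl_closure_sub _ _ cC DC) CG.
- move=> shrink A B cA cB AB0.
  have [|E [oE AE _ EB]] := shrink _ _ cA (sl_closedC _ cB).
    by move=> y Ay By; rewrite -[False]/(set0 y) -AB0.
  exists E, (~` sl_closure gamma E); split=> //.
  + exact/sl_closedC/sl_closed_sl_closure.
  + by move=> y By /EB.
  + by apply/seteqP; split=> // y [Ey]; apply; apply: sub_sl_closure.
- move=> sep.
  have sl_closure_disj U V : sl_open gamma V -> U `&` V = set0 ->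
      sl_closure gamma U `&` V = set0.
    move=> oV UV0; apply/seteqP; split=> // y [Uy Vy].
    by have [z [Vz Uz]] := Uy _ oV Vy; rewrite -[_ y]/(set0 z) -UV0.
  move=> A B cA cB AB0.
  have [E [F [oE oF AE BF EF0]]] := sep _ _ cA cB AB0.
  have [|U [V [oU oV EU BV UV0]]] :=
      sep _ _ (sl_closed_sl_closure gamma_gt E) cB.
    apply/seteqP; split=> // y [Ey /BF Fy].
    by rewrite -(sl_closure_disj _ _ oF EF0).
  (* E stays inside U through its closure, while the closure of V avoids U. *)
  exists E, V; split=> //; apply/seteqP; split=> // y [/EU Uy Vy].
  by rewrite -(sl_closure_disj V U oU) // setIC.
Qed.
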